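(* Let $a(x),b(x)$ be smooth real functions with $b>0$ and $c=b-a^2>0$, with diagonal nodal matrices $\mathbf a,\mathbf c\in\mathbb{R}^{(2P+2)\times(2P+2)}$ of $a$ and $c$. Let $\mathbf U(t),\mathbf W(t)\in\mathbb{R}^{2P+2}$ be a solution of the semi-discrete two-element interface scheme, written in the form $$\frac{d}{dt}\mathbf U=\mathbf W,\qquad \frac{d}{dt}\mathbf W=\mathbf a\widetilde{\mathbf D}\mathbf W+\widetilde{\mathbf D}(\mathbf a\mathbf W)-\mathbf H^{-1}\widetilde{\mathbf D}^T\mathbf c\mathbf H\widetilde{\mathbf D}\mathbf U,$$ for which the external boundary contribution vanishes, i.e. $\mathbf W^T\widetilde{\mathbf B}\,\mathbf a\mathbf W=0$ for all $t$. Then the discrete energy $$\mathcal E_c(t)=\langle\mathbf W,\mathbf W\rangle_{\mathbf H}+\mathbf U^T\widetilde{\mathbf D}^T\mathbf c\mathbf H\widetilde{\mathbf D}\mathbf U$$ satisfies $\frac{d}{dt}\mathcal E_c(t)=0$.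
   Context: Element operators: let $P\ge 1$, let $-1=\xi_1<\dots<\xi_{P+1}=1$ be the Gauss-Legendre-Lobatto nodes on $[-1,1]$ with positive weights $\omega_j$ (quadrature exact for polynomials of degree $\le 2P-1$), and let $\phi_i$ be the Lagrange polynomials of degree $P$ with $\phi_i(\xi_j)=\delta_{ij}$. Set $Q_{ij}=\sum_m\omega_m\phi_i(\xi_m)\phi_j'(\xi_m)$; for an element of length $\Delta x>0$ set $H_x=\frac{\Delta x}{2}\mathrm{diag}(\omega_1,\dots,\omega_{P+1})$, $D_x=H_x^{-1}Q$. Two-element operators: the domain is $[B_-,B_+]=\Omega_-\cup\Omega_+$, two elements of length $\Delta x$ meeting at $x_I$; grid vectors in $\mathbb{R}^{2P+2}$ list first the $P+1$ nodal values on $\Omega_-$, then those on $\Omega_+$ (the node $x_I$ is doubled). With $e_l=(1,0,\dots,0)^T$, $e_r=(0,\dots,0,1)^T\in\mathbb{R}^{P+1}$, $$\mathbf H=\begin{pmatrix}H_x&0\\0&H_x\end{pmatrix},\quad \mathbf D=\begin{pmatrix}D_x&0\\0&D_x\end{pmatrix},\quad \widehat{\mathbf B}=\begin{pmatrix}e_re_r^T&-e_re_l^T\\ e_le_r^T&-e_le_l^T\end{pmatrix},\quad \widetilde{\mathbf B}=\begin{pmatrix}-e_le_l^T&0\\0&e_re_r^T\end{pmatrix},$$ $\widetilde{\mathbf D}=\mathbf D-\frac12\mathbf H^{-1}\widehat{\mathbf B}$, $\langle\mathbf U,\mathbf V\rangle_{\mathbf H}=\mathbf V^T\mathbf H\mathbf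 U$. The scheme discretises the shifted wave equation $\partial_t(u_t-au_x)-\partial_x(a(u_t-au_x)+bu_x)=0$; contributions from the external boundaries $B_\pm$ are ignored. *)

(* Defs.v *)
From HB Require Import structures.
From mathcomp Require Export all_boot all_order all_algebra.
From mathcomp Require Export all_classical all_reals all_analysis.
Export Order.TTheory GRing.Theory Num.Theory.
Export numFieldNormedType.Exports.

Set Implicit Arguments.
Unset Strict Implicit.
Unset Printing Implicit Defensive.

Local Open Scope classical_set_scope.
Local Open Scope ring_scope.

(* Rodrigues' formula. *)
Definition legendre (R : realType) (n : nat) : {poly R} :=
  (2 ^+ n * n`!%:R)^-1 *: derivn n (('X ^+ 2 - 1) ^+ n).

(* The GLL nodes are -1, 1 and the zeros of the derivative of the Legendre
   polynomial of degree P.  Indices run over 0, ..., P. *)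
Record gauss_legendre_lobatto (R : realType) (P : nat)
    (xi omega : 'I_P.+1 -> R) : Prop := GaussLegendreLobatto {
  gll_left : xi ord0 = -1 ;
  gll_right : xi ord_max = 1 ;
  gll_increasing : forall i j : 'I_P.+1, (i < j)%N -> xi i < xi j ;
  gll_interior : forall i : 'I_P.+1, i != ord0 -> i != ord_max ->
    root (legendre R P)^`() (xi i) ;
  gll_weight_gt0 : forall i : 'I_P.+1, 0 < omega i ;
  (* size p is the degree plus one, so this covers the degrees <= 2P - 1. *)
  gll_exact : forall p : {poly R}, (size p <= 2 * P)%N ->
    \sum_(i < P.+1) omega i * p.[xi i] =
      \int[@lebesgue_measure R]_(x in `[(-1 : R), 1]) p.[x]
}.

(* The lagrange basis of qpoly samples at an injective sequence nat -> R,
   which a finite family of nodes does not provide. *)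
Definition lagrange_poly (R : realType) (n : nat) (xi : 'I_n -> R) (i : 'I_n) :
    {poly R} :=
  \prod_(j < n | j != i) ((xi i - xi j)^-1 *: ('X - (xi j)%:P)).

Section Element.
Variables (R : realType) (P : nat) (xi omega : 'I_P.+1 -> R) (dx : R).

Definition elem_Q : 'M[R]_P.+1 :=
  \matrix_(i, j) \sum_(m < P.+1)
    omega m * (lagrange_poly xi i).[xi m] * (lagrange_poly xi j)^`().[xi m].

Definition elem_H : 'M[R]_P.+1 := (dx / 2) *: diag_mx (\row_i omega i).

Definition elem_D : 'M[R]_P.+1 := invmx elem_H *m elem_Q.

Definition e_l : 'cV[R]_P.+1 := delta_mx ord0 0.
Definition e_r : 'cV[R]_P.+1 := delta_mx ord_max 0.

Definition grid_H : 'M[R]_(P.+1 + P.+1) := block_mx elem_H 0 0 elem_H.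

Definition grid_D : 'M[R]_(P.+1 + P.+1) := block_mx elem_D 0 0 elem_D.

Definition grid_Bhat : 'M[R]_(P.+1 + P.+1) :=
  block_mx (e_r *m e_r^T) (- (e_r *m e_l^T))
           (e_l *m e_r^T) (- (e_l *m e_l^T)).

Definition grid_Btilde : 'M[R]_(P.+1 + P.+1) :=
  block_mx (- (e_l *m e_l^T)) 0 0 (e_r *m e_r^T).

Definition grid_Dtilde : 'M[R]_(P.+1 + P.+1) :=
  grid_D - 2^-1 *: (invmx grid_H *m grid_Bhat).

(* The physical nodes of the element [x0, x0 + dx] are the images of the
   reference nodes under the affine map from [-1, 1]. *)
Definition elem_node (x0 : R) (i : 'I_P.+1) : R := x0 + dx / 2 * (xi i + 1).

(* The domain is [Bm, Bm + dx] followed by [Bm + dx, Bm + 2 dx]. *)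
Definition nodal_mx (Bm : R) (f : R -> R) : 'M[R]_(P.+1 + P.+1) :=
  diag_mx (row_mx (\row_i f (elem_node Bm i))
                  (\row_i f (elem_node (Bm + dx) i))).

Definition inner_H (U V : 'cV[R]_(P.+1 + P.+1)) : R :=
  (V^T *m grid_H *m U) 0 0.

Definition discrete_energy (c : 'M[R]_(P.+1 + P.+1))
    (U W : 'cV[R]_(P.+1 + P.+1)) : R :=
  inner_H W W
  + (U^T *m grid_Dtilde^T *m c *m grid_H *m grid_Dtilde *m U) 0 0.

End Element.

(* f is the restriction to A of a C^oo function on the line; on a compact
   interval this is the usual smoothness up to the boundary. *)
Definition smooth_on (R : realType) (A : set R) (f : R -> R) : Prop :=
  exists2 g : R -> R, (forall (n : nat) (x : R), derivable (derive1n n g) x 1)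
    & (forall x, A x -> f x = g x).

(* Main.v *)
(* Exactness of the quadrature on (phi_i phi_j)' gives summation by parts on
   each element, Q + Q^T = e_r e_r^T - e_l e_l^T.  The correction by Bhat
   cancels the interface terms, so that H Dt + (H Dt)^T = Btilde.  In
   dE/dt = 2 W^T H W' + 2 W^T K U with K = Dt^T c H Dt, the K terms cancel and
   the terms in a combine, as a commutes with the diagonal H, into
   2 W^T (H Dt + (H Dt)^T) a W = 2 W^T Btilde a W = 0. *)
Require Import Defs.
From mathcomp Require Import zify ring lra.

Set Implicit Arguments.
Unset Strict Implicit.
Unset Printing Implicit Defensive.

Local Open Scope classical_set_scope.
Local Open Scope ring_scope.

Lemma trmx11 (T : Type) (A : 'M[T]_1) : A^T = A.
Proof. by apply/matrixP => i j; rewrite mxE !ord1. Qed.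

Section MatrixCalculus.
Variables (R : realFieldType) (V : normedModType R).

(** Reduces matrix calculus to real-valued functions, where the sum and product rules are
    applied. *)
Lemma is_derive_mxP m n (M : V -> 'M[R]_(m, n)) dM t v :
  is_derive t v M dM <->
  forall i j, is_derive t v (fun x => M x i j) (dM i j).
Proof.
split=> [[dvM <-] i j|dvM].
  have dvMij := (derivable_mxP M t v).1 dvM i j.
  by apply: DeriveDef => //; rewrite derive_mx // mxE.
have derM : derivable M t v by apply/derivable_mxP => i j; case: (dvM i j).
apply: DeriveDef => //; rewrite derive_mx //.
by apply/matrixP => i j; rewrite mxE; case: (dvM i j).
Qed.

Lemma is_derive_mulmx m n p (M : V -> 'M[R]_(m, n)) (N : V -> 'M[R]_(n, p))
    dM dN t v :
  is_derive t v M dM -> is_derive t v N dN ->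
  is_derive t v (fun x => M x *m N x) (dM *m N t + M t *m dN).
Proof.
move=> /is_derive_mxP dMij /is_derive_mxP dNij; apply/is_derive_mxP => i j.
have -> : (fun x => (M x *m N x) i j) =
    \sum_(k < n) (fun x => M x i k) * (fun x => N x k j).
  by apply/funext => x; rewrite mxE fct_sumE.
apply: is_derive_eq.
rewrite !mxE -big_split /=; apply: eq_bigr => k _.
by rewrite addrC; congr (_ + _); rewrite /GRing.scale /= mulrC.
Qed.

Lemma is_derive_trmx m n (M : V -> 'M[R]_(m, n)) dM t v :
  is_derive t v M dM -> is_derive t v (fun x => (M x)^T) dM^T.
Proof.
move=> /is_derive_mxP dMij; apply/is_derive_mxP => i j.
have -> : (fun x => (M x)^T i j) = (fun x => M x j i).
  by apply/funext => x; rewrite mxE.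
by rewrite mxE.
Qed.

(** The two terms of the product rule are 1 x 1 matrices, transposes of each other because [S] is
    symmetric; hence they coincide and add up to a double. *)
Lemma is_derive_quadratic n (S : 'M[R]_n) (M : V -> 'cV[R]_n) dM t v :
  S^T = S -> is_derive t v M dM ->
  is_derive t v (fun x => ((M x)^T *m S *m M x) 0 0)
    (((M t)^T *m S *m dM) 0 0 *+ 2).
Proof.
move=> symS derM.
have dS : is_derive t v (fun _ => S) 0 by exact: is_derive_cst.
have dE := is_derive_mulmx (is_derive_mulmx (is_derive_trmx derM) dS) derM.
have := (is_derive_mxP _ _ _ _).1 dE 0 0; move=> /is_derive_eq; apply.
rewrite mulmx0 addr0 mxE mulr2n; congr (_ + _).
by rewrite -[_ *m M t]trmx11 !trmx_mul trmxK symS mulmxA.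
Qed.

End MatrixCalculus.

Lemma quadratic_power_balance (R : comUnitRingType) n
    (H D a K : 'M[R]_n) (u w : 'cV[R]_n) :
  H \in unitmx -> a^T = a -> H *m a = a *m H ->
  w^T *m H *m (a *m D *m w + D *m (a *m w) - invmx H *m K *m u)
  = w^T *m (H *m D + (H *m D)^T) *m a *m w - w^T *m K *m u.
Proof.
move=> unitH syma comm_aH.
rewrite mulmxBr mulmxDr !mulmxA mulmxK //; congr (_ - _).
rewrite mulmxDr !mulmxDl addrC !mulmxA; congr (_ + _).
(* The scalar [w^T *m (H *m D)^T *m a *m w] equals its transpose [w^T *m a *m H *m D *m w];
   commuting [a] with [H] then gives the term in [a *m D]. *)
rewrite -[RHS]trmx11.
by rewrite !trmx_mul !trmxK syma !mulmxA -(mulmxA _ H a) comm_aH !mulmxA.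
Qed.

Lemma Rintegral_deriv (R : realType) (p : {poly R}) (x y : R) : x < y ->
  \int[@lebesgue_measure R]_(z in `[x, y]) p^`().[z] = p.[y] - p.[x].
Proof.
move=> xy; rewrite /Rintegral (@continuous_FTC2 _ _ (horner p)) //.
- exact/continuous_subspaceT/continuous_horner.
- split.
  + by move=> z _; exact: derivable_horner.
  + exact/cvg_at_right_filter/continuous_horner.
  + exact/cvg_at_left_filter/continuous_horner.
- by move=> z _; rewrite derivE.
Qed.

Section Lagrange.
Variables (R : realType) (n : nat) (xi : 'I_n -> R).

Lemma lagrange_poly_node (i j : 'I_n) : injective xi ->
  (lagrange_poly xi i).[xi j] = (i == j)%:R.
Proof.
move=> inj_xi; rewrite /lagrange_poly horner_prod.
have [<-|neq_ij] := eqVneq i j; last first.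
  by rewrite (bigD1 j) 1?eq_sym //= !hornerE subrr mulr0 mul0r.
apply: big1 => k neq_ki; rewrite !hornerE mulVf // subr_eq0.
by rewrite (inj_eq inj_xi) eq_sym.
Qed.

Lemma size_lagrange_poly (i : 'I_n) : (size (lagrange_poly xi i) <= n)%N.
Proof.
apply: leq_trans (size_poly_prod_leq _ _) _.
rewrite cardC1 card_ord.
have : (\sum_(j < n | j != i) size ((xi i - xi j)^-1 *: ('X - (xi j)%:P)) <=
        \sum_(j < n | j != i) 2)%N.
  by apply: leq_sum => j _; rewrite (leq_trans (size_scale_leq _ _)) ?size_XsubC.
rewrite sum_nat_const cardC1 card_ord.
(* The bound is [(2 * n.-1).+1 - n.-1], which is [n] only for positive [n]; the index [i] ensures
   this. *)
by move: (\sum_(j < n | _) _)%N (ltn_ord i) => s; lia.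
Qed.

End Lagrange.

Section ElementOperators.
Variables (R : realType) (P : nat) (xi omega : 'I_P.+1 -> R) (dx : R).
Hypothesis gll : gauss_legendre_lobatto xi omega.
Hypothesis dx_gt0 : 0 < dx.

Lemma gll_inj : injective xi.
Proof.
move=> i j eq_xi; apply: val_inj.
by case: (ltngtP i j) => // /(gll_increasing gll); rewrite eq_xi ltxx.
Qed.

(* The integrand (phi_i phi_j)' has degree 2P - 1, so the quadrature
   integrates it exactly. *)
Lemma elem_Q_sbp :
  elem_Q xi omega + (elem_Q xi omega)^T =
  e_r R P *m (e_r R P)^T - e_l R P *m (e_l R P)^T.
Proof.
apply/matrixP => i j.
have size_phi k := size_lagrange_poly xi k.
have size_d : (size (lagrange_poly xi i * lagrange_poly xi j)^`() <= 2 * P)%N.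
  (* A derivative is built as a [\poly] of length [(size p).-1], and here [size p] is at most
     [2 * P + 1]. *)
  apply: leq_trans (size_poly _ _) _.
  have := size_polyMleq (lagrange_poly xi i) (lagrange_poly xi j).
  by have := size_phi i; have := size_phi j; lia.
have := gll_exact gll size_d; rewrite Rintegral_deriv; last by lra.
(* Once the endpoints are read as nodes, the boundary values of the basis polynomials are Kronecker
   deltas. *)
rewrite -(gll_left gll) -(gll_right gll) !hornerM.
rewrite !lagrange_poly_node; try exact: gll_inj.
rewrite /e_r /e_l !trmx_delta !mul_delta_mx !mxE => E.
rewrite -!natrM !mulnb in E.
rewrite -E -big_split /=; apply: eq_bigr => m _.
by rewrite derivM !hornerE; ring.
Qed.

Lemma elem_H_diag : elem_H omega dx = diag_mx (\row_i (dx / 2 * omega i)).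
Proof.
by rewrite /elem_H -linearZ; congr diag_mx; apply/rowP => i; rewrite !mxE.
Qed.

Lemma elem_H_unitmx : elem_H omega dx \in unitmx.
Proof.
rewrite elem_H_diag unitmxE det_diag unitfE; apply/prodf_neq0 => i _.
by rewrite mxE lt0r_neq0 // mulr_gt0 ?divr_gt0 // (gll_weight_gt0 gll).
Qed.

Lemma grid_H_diag : grid_H omega dx =
  diag_mx (row_mx (\row_i (dx / 2 * omega i)) (\row_i (dx / 2 * omega i))).
Proof. by rewrite /grid_H elem_H_diag diag_mx_row. Qed.

Lemma grid_H_unitmx : grid_H omega dx \in unitmx.
Proof.
by rewrite /grid_H unitmxE det_ublock unitrM -!unitmxE elem_H_unitmx.
Qed.

(** The off-diagonal blocks of [grid_Bhat] are negative transposes of each other and cancel in the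
    symmetrisation. Its diagonal blocks remove the term of [e_r] on the left element and that of
    [e_l] on the right one, which leaves the external boundary. *)
Lemma grid_Dtilde_sbp :
  let HD := grid_H omega dx *m grid_Dtilde xi omega dx in
  HD + HD^T = grid_Btilde R P.
Proof.
rewrite /= /grid_Dtilde mulmxBr -scalemxAr mulKVmx ?grid_H_unitmx //.
have -> : grid_H omega dx *m grid_D xi omega dx =
    block_mx (elem_Q xi omega) 0 0 (elem_Q xi omega).
  rewrite /grid_H /grid_D mulmx_block !mulmx0 !mul0mx !addr0 !add0r.
  by rewrite /elem_D mulKVmx ?elem_H_unitmx.
rewrite /grid_Bhat /grid_Btilde scale_block_mx opp_block_mx add_block_mx.
rewrite tr_block_mx add_block_mx.
have rrT : (e_r R P *m (e_r R P)^T)^T = e_r R P *m (e_r R P)^T.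
  by rewrite trmx_mul trmxK.
have llT : (e_l R P *m (e_l R P)^T)^T = e_l R P *m (e_l R P)^T.
  by rewrite trmx_mul trmxK.
have -> : e_l R P *m (e_r R P)^T = (e_r R P *m (e_l R P)^T)^T.
  by rewrite trmx_mul trmxK.
move: elem_Q_sbp rrT llT.
(* With the outer products and [elem_Q] abstracted, each block identity is linear in the entries. *)
move: (e_r R P *m _) (e_l R P *m _) (e_r R P *m _) (elem_Q xi omega).
move=> rr ll rl Q sbpQ rrT llT.
by congr block_mx; apply/matrixP => i j;
  move/matrixP/(_ i j): sbpQ; move/matrixP/(_ i j): rrT;
  move/matrixP/(_ i j): llT; rewrite !mxE; lra.
Qed.

End ElementOperators.

Theorem theorem12 (R : realType) (P : nat) (hP : (1 <= P)%N)
  (xi omega : 'I_P.+1 -> R) (hGLL : gauss_legendre_lobatto xi omega)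
  (Bm dx : R) (hdx : 0 < dx)
  (a b : R -> R)
  (ha : smooth_on `[Bm, Bm + 2 * dx] a)
  (hb : smooth_on `[Bm, Bm + 2 * dx] b)
  (hb_gt0 : forall x, x \in `[Bm, Bm + 2 * dx] -> 0 < b x)
  (hc_gt0 : forall x, x \in `[Bm, Bm + 2 * dx] -> 0 < b x - a x ^+ 2)
  (J : set R) (hJ : open J)
  (U W : R -> 'cV[R]_(P.+1 + P.+1)) :
  let am := nodal_mx xi dx Bm a in
  let cm := nodal_mx xi dx Bm (fun x => b x - a x ^+ 2) in
  let H := grid_H omega dx in
  let D := grid_Dtilde xi omega dx in
  (forall t, J t -> is_derive t 1 U (W t)) ->
  (forall t, J t -> is_derive t 1 W
     (am *m D *m W t + D *m (am *m W t)
      - invmx H *m D^T *m cm *m H *m D *m U t)) ->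
  (forall t, J t -> (W t)^T *m grid_Btilde R P *m am *m W t = 0) ->
  forall t, J t ->
    is_derive t 1 (fun s => discrete_energy xi omega dx cm (U s) (W s)) 0.
Proof.
move=> am cm H D dU dW boundary t Jt.
have unitH : H \in unitmx by exact: grid_H_unitmx hGLL hdx.
have symH : H^T = H by rewrite /H grid_H_diag tr_diag_mx.
have syma : am^T = am by rewrite tr_diag_mx.
have comm_aH : H *m am = am *m H by rewrite /H grid_H_diag diag_mxC.
pose K := D^T *m cm *m H *m D.
(* Transposition swaps the factors [cm] and [H], which commute as diagonal matrices. *)
have symK : K^T = K.
  rewrite /K !trmx_mul trmxK symH tr_diag_mx !mulmxA -!(mulmxA D^T).
  by rewrite /H grid_H_diag diag_mxC.
have := dW t Jt.
rewrite (_ : invmx H *m D^T *m cm *m H *m D *m U t = invmx H *m K *m U t);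
  last by rewrite /K !mulmxA.
move=> /(is_derive_quadratic symH).
(* The terms in [am] form the boundary term and vanish, so [W^T H W] has derivative
   [- 2 W^T K U]. *)
rewrite quadratic_power_balance // grid_Dtilde_sbp // boundary // sub0r.
have := is_derive_quadratic symK (dU t Jt) => dEU dEW.
have -> : (fun s => discrete_energy xi omega dx cm (U s) (W s)) =
    (fun s => ((W s)^T *m H *m W s) 0 0) + (fun s => ((U s)^T *m K *m U s) 0 0).
  by apply/funext => s; rewrite /discrete_energy fctE /K !mulmxA.
apply: is_derive_eq.
(* The derivative [2 U^T K W] of the potential part is a scalar; transposing it exhibits the
   opposite of the other part. *)
have -> : (U t)^T *m K *m W t = (W t)^T *m K *m U t.
  by rewrite -[LHS]trmx11 2!trmx_mul trmxK symK mulmxA.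
by rewrite mxE mulNrn addNr.
Qed.
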